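(* Let $p$ be a prime, let $\mathcal E$ be a semisaturated fusion system on a finite $p$-group $P$ and let $Q$ be a fully normalized $\mathcal E$-centric subgroup of $P$. Then $Q$ is $\mathcal E$-essential if and only if $\mathrm{Out}_{\mathcal E}(Q)$ has a strongly $\mathrm{Out}_P(Q)$-embedded subgroup.
   Context: All groups are finite and maps are written on the right. Fusion systems and saturated fusion systems on finite $p$-groups are understood in the standard sense. Semisaturated: a fusion system $\mathcal E$ on a $p$-group $P$ is semisaturated if there exist a $p$-group $S\ge P$ and a saturated fusion system $\mathcal F\ge\mathcal E$ on $S$ such that $P$ is strongly $\mathcal F$-closed (i.e. $x\phi\in P$ for all $x\in P$, $\phi\in\mathrm{Hom}_{\mathcal F}(\langle x\rangle,S)$) and $\mathcal E=\mathcal F_{|\le P}$, i.e. $\mathrm{Hom}_{\mathcal E}(A,B)=\mathrm{Hom}_{\mathcal F}(A,B)$ for all $A,B\le P$. For a fusion system $\mathcal E$ on $P$: $Q^{\mathcal E}$ denotes the set of $\mathcal E$-conjugates of $Q$; $c_x$ denotes conjugation by $x$. $Q\le P$ is fully ($\mathcal E$-)normalized if $|N_P(Q)|\ge|N_P(R)|$ for all $R\in Q^{\mathcal E}$, and $\mathcal E$-centric if $C_P(R)\le R$ for all $R\in Q^{\mathcal E}$. For $\phi\in\mathrm{Hom}_{\mathcal E}(Q,P)$, put $$N_\phi(Q)=\{x\in N_P(Q)\mid \exists\, y\in N_P(Q\phi)\text{ such that }\phi^{-1}c_x\phi=c_y\text{ on }Q\phi\}.$$ $Q$ is receptive if every $\mathcal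 E$-isomorphism $\phi:R\to Q$ extends to some $\overline\phi\in\mathrm{Hom}_{\mathcal E}(N_\phi(R),P)$. A proper subgroup $R<P$ is reproductive if $R$ is receptive and for each $Q\in R^{\mathcal E}$ there exists $\psi\in\mathrm{Hom}_{\mathcal E}(Q,R)$ with $N_\psi(Q)>Q$. $Q$ is $\mathcal E$-essential if $Q$ is reproductive (in particular proper in $P$) and $\langle\phi\in\mathrm{Aut}_{\mathcal E}(Q)\mid N_\phi(Q)>Q\rangle$ is proper in $\mathrm{Aut}_{\mathcal E}(Q)$. $\mathrm{Aut}_P(Q)$ is the group of automorphisms of $Q$ induced by conjugation by elements of $N_P(Q)$; $\mathrm{Out}_{\mathcal E}(Q)=\mathrm{Aut}_{\mathcal E}(Q)/\mathrm{Inn}(Q)$ and $\mathrm{Out}_P(Q)=\mathrm{Aut}_P(Q)/\mathrm{Inn}(Q)$. For $D\le T\le G$, $D$ is strongly closed in $T$ with respect to $G$ if $x^g\in D$ whenever $x\in D$, $g\in G$ and $x^g\in T$. If $T\in\mathrm{Syl}_p(G)$ and $D>1$ is strongly closed in $T$ with respect to $G$, a proper subgroup $H<G$ is strongly $D$-embedded in $G$ if (i) $D^x\le H$ for some $x\in G$; (ii) for all $g\in G\setminus H$, $H\cap H^g$ contains no $G$-conjugate of any nontrivial subgroup $U$ of $D$. (In particular, having a strongly $D$-embedded subgroup entails $D>1$. For $Q$ fully $\mathcal E$-normalized, $\mathrm{Out}_P(Q)$ is strongly closed, with respect to $\mathrm{Out}_{\mathcal E}(Q)$, in any Sylow $p$-subgroup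 of $\mathrm{Out}_{\mathcal E}(Q)$ containing it.) *)

(* Defs.v *)
From mathcomp Require Import all_boot all_fingroup all_solvable.

Set Implicit Arguments.
Unset Strict Implicit.
Unset Printing Implicit Defensive.

Local Open Scope group_scope.

(* A morphism A -> B is represented by any function gT -> gT with the right
   values on A ([fus_ext] makes the values outside A irrelevant). Maps act on
   the right in the source, so (phi psi) there is [psi \o phi] here, while the
   product of permutations and [x ^ y = y^-1 * x * y] already follow the
   right-action convention. *)
Record fusion_system (gT : finGroupType) (P : {group gT}) := FusionSystem {
  fus_hom :> {group gT} -> {group gT} -> (gT -> gT) -> bool;
  fus_sub : forall (A B : {group gT}) f, fus_hom A B f ->
    A \subset P /\ B \subset P;
  fus_inj : forall (A B : {group gT}) f, fus_hom A B f ->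
    [/\ {in A &, {morph f : x y / x * y}}, {in A &, injective f}
      & f @: A \subset B];
  fus_ext : forall (A B : {group gT}) f g, {in A, f =1 g} ->
    fus_hom A B f = fus_hom A B g;
  fus_conj : forall (A B : {group gT}) x, A \subset P -> B \subset P ->
    x \in P -> A :^ x \subset B -> fus_hom A B (conjg^~ x);
  fus_comp : forall (A B C : {group gT}) f g,
    fus_hom A B f -> fus_hom B C g -> fus_hom A C (g \o f);
  (* every morphism is an isomorphism onto its image, followed by inclusion *)
  fus_iso : forall (A B : {group gT}) f, fus_hom A B f ->
    exists C : {group gT},
      [/\ f @: A = C, fus_hom A C f
        & exists2 g, fus_hom C A g & {in A, cancel f g}]
}.

Section Fusion.

Variables (gT : finGroupType) (P : {group gT}) (E : fusion_system P).
Implicit Types (Q R : {group gT}) (f : gT -> gT).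

Definition fus_isom Q R f : Prop := E Q R f /\ f @: Q = R.

Definition fus_conjugate Q R : Prop := exists f, fus_isom Q R f.

Definition fully_normalized Q : Prop :=
  Q \subset P /\ forall R, fus_conjugate Q R -> #|'N_P(R)| <= #|'N_P(Q)|.

Definition fus_centric Q : Prop :=
  Q \subset P /\ forall R, fus_conjugate Q R -> 'C_P(R) \subset R.

Definition strongly_fus_closed (D : {set gT}) : Prop :=
  forall x f, x \in D -> E <[x]>%G P f -> f x \in D.

(* N_phi(Q): the condition phi^-1 c_x phi = c_y on Q phi is stated at the
   points z phi, z \in Q. *)
Definition Nphi f (Q : {group gT}) : {set gT} :=
  [set x in 'N_P(Q) | [exists y in 'N_P(f @: Q),
     [forall z in Q, f (z ^ x) == f z ^ y]]].

Lemma group_set_Nphi f Q : group_set (Nphi f Q).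
Proof.
apply/group_setP; split.
  rewrite inE group1 /=; apply/existsP; exists 1; rewrite group1 /=.
  by apply/forall_inP=> z _; rewrite !conjg1.
move=> x1 x2 /setIdP[Nx1 /existsP[y1 /andP[Ny1 /forall_inP e1]]].
case/setIdP=> Nx2 /existsP[y2 /andP[Ny2 /forall_inP e2]].
rewrite inE groupM //=; apply/existsP; exists (y1 * y2); rewrite groupM //=.
apply/forall_inP=> z Qz; rewrite !conjgM -(eqP (e1 z Qz)); apply: e2.
by case/setIP: Nx1 => _ nQx1; rewrite memJ_norm.
Qed.

Canonical Nphi_group f Q := Group (group_set_Nphi f Q).

Definition receptive Q : Prop :=
  forall R f, fus_isom R Q f ->
    exists2 g, E (Nphi_group f R) P g & {in R, g =1 f}.

Definition reproductive R : Prop :=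
  [/\ R \proper P, receptive R
    & forall Q, fus_conjugate R Q -> exists2 f, E Q R f & Q \proper Nphi f Q].

Definition AutE Q : {set {perm gT}} := [set a in Aut Q | E Q Q a].

Lemma group_set_AutE Q : Q \subset P -> group_set (AutE Q).
Proof.
move=> sQP; apply/group_setP; split.
  rewrite inE group1 /= -(fus_ext E Q (f := conjg^~ 1)).
    by rewrite fus_conj // conjsg1.
  by move=> x _; rewrite conjg1 perm1.
move=> a b /setIdP[Aa Ea] /setIdP[Ab Eb]; rewrite inE groupM //=.
rewrite -(fus_ext E Q (f := b \o a)) ?(fus_comp Ea Eb) // => x _ /=.
by rewrite permM.
Qed.

(* [conj_aut Q x] is z |-> z ^ x on Q. *)
Definition AutP Q : {set {perm gT}} := conj_aut Q @* 'N_P(Q).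

Definition Inn Q : {group {perm gT}} := (conj_aut Q @* Q)%G.

Definition OutE Q : {set coset_of (Inn Q)} := AutE Q / Inn Q.

Definition OutP Q : {set coset_of (Inn Q)} := AutP Q / Inn Q.

Definition essential Q : Prop :=
  reproductive Q /\
  <<[set a in AutE Q | Q \proper Nphi a Q]>> \proper AutE Q.

Definition saturated (p : nat) : Prop :=
  forall Q, Q \subset P ->
    exists R, [/\ fus_conjugate Q R, p.-Sylow(AutE R) (AutP R) & receptive R].

End Fusion.

(* The overgroup S need not live in the ambient group of P, so P <= S is an
   embedding iota; the last clause identifies Hom_E(A, B) with
   Hom_F(A iota, B iota) for all A, B <= P. *)
Definition semisaturated (p : nat) (gT : finGroupType) (P : {group gT})
    (E : fusion_system P) : Prop :=
  exists (sT : finGroupType) (S : {group sT}) (F : fusion_system S)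
         (iota : {morphism P >-> sT}) (inj_iota : 'injm iota),
    [/\ p.-group S, saturated F p, iota @* P \subset S,
        strongly_fus_closed F (iota @* P)
      & forall (A B : {group gT}) (f : gT -> gT),
          A \subset P -> B \subset P -> f @: A \subset B ->
          E A B f
            = F (iota @* A)%G (iota @* B)%G (iota \o f \o invm inj_iota)].

Definition strongly_closed (rT : finGroupType) (D T G : {set rT}) : Prop :=
  [/\ D \subset T, T \subset G
    & forall x g, x \in D -> g \in G -> x ^ g \in T -> x ^ g \in D].

(* The first two clauses are the standing hypotheses on D under which the
   notion is defined. *)
Definition strongly_embedded (p : nat) (rT : finGroupType) (D G : {set rT})
    (H : {group rT}) : Prop :=
  [/\ exists2 T : {group rT}, p.-Sylow(G) T & strongly_closed D T G,
      D != 1,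
      H \proper G,
      exists2 x, x \in G & D :^ x \subset H
    & forall (g x : rT) (U : {group rT}), g \in G :\: H -> x \in G ->
        U \subset D -> U :!=: 1 -> ~~ (U :^ x \subset H :&: H :^ g)].

(* Main.v *)
(* Let F on S >= P witness semisaturation. A receptive F-conjugate R of Q with
   Aut_S(R) a Sylow subgroup lies in P, and the extension property of R relative
   to T = Aut_S(R), being stable under restriction to P, is a statement about E
   alone. If Q is fully normalized, an extension of some Q -> R identifies
   N_P(Q) with N_P(R) and carries this property back to Q. It implies that Q is
   receptive (and reproductive if proper in P) and that D = Out_P(Q) is strongly
   closed in a Sylow subgroup of G = Out_E(Q).
   As Q is centric, N_a(Q) > Q means that D meets D^a nontrivially, so the
   claim becomes: for D <> 1, G has a strongly D-embedded subgroup iff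
   H = <g in G | D meets D^g nontrivially> is proper in G. A strongly embedded
   subgroup containing D contains H; conversely H contains the Sylow subgroup
   T, which normalizes D, and if U^x <= H with 1 <> U <= D then conjugating U^x
   into T within H and using strong closure gives x in H. *)

Require Import Defs.
From mathcomp Require Import all_boot all_fingroup all_solvable.

Set Implicit Arguments.
Unset Strict Implicit.
Unset Printing Implicit Defensive.

Local Open Scope group_scope.

(** * Restriction, corestriction, inversion and transport of conjugation for morphisms of a fusion
    system *)

Section FusionBasics.

Variables (gT : finGroupType) (P : {group gT}) (E : fusion_system P).
Implicit Types (A B C Q R : {group gT}) (f g : gT -> gT).

Lemma fus_incl A B : A \subset B -> B \subset P -> E A B id.
Proof.
move=> sAB sBP; rewrite (fus_ext E B (g := conjg^~ 1)) => [|x _]; last first.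
  by rewrite conjg1.
by rewrite fus_conj ?conjsg1 // (subset_trans sAB).
Qed.

Lemma fus_restr A B C f : C \subset A -> E A B f -> E C B f.
Proof.
move=> sCA EABf; have [sAP _] := fus_sub EABf.
exact: fus_comp (fus_incl sCA sAP) EABf.
Qed.

Lemma fus_corestr A B C f : f @: A \subset C -> C \subset P ->
  E A B f -> E A C f.
Proof.
move=> sfC sCP /fus_iso[D [defD EADf _]]; rewrite defD in sfC.
exact: fus_comp EADf (fus_incl sfC sCP).
Qed.

Lemma fus_mem A B f x : E A B f -> x \in A -> f x \in B.
Proof. by case/fus_inj=> _ _ /subsetP sfB Ax; rewrite sfB ?imset_f. Qed.

Lemma fus_mor A B f : E A B f ->
  exists2 F : {morphism A >-> gT}, F =1 f & 'injm F.
Proof.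
by case/fus_inj=> fM finj _; exists (Morphism fM); last exact/injmP.
Qed.

Lemma fusJ A B f : E A B f -> {in A &, {morph f : x y / x ^ y}}.
Proof.
case/fus_mor=> F eqF _ x y Ax Ay.
by rewrite -!eqF morphJ.
Qed.

Lemma card_fus A B f C : E A B f -> C \subset A -> #|f @: C| = #|C|.
Proof.
case/fus_inj=> _ finj _ /subsetP sCA.
by rewrite card_in_imset //; apply: sub_in2 finj.
Qed.

Lemma fus_isomP Q f : E Q Q f -> f @: Q = Q.
Proof.
move=> EQf; apply/eqP; rewrite eqEcard (card_fus EQf) // leqnn andbT.
by have [] := fus_inj EQf.
Qed.

Lemma fus_isom_inv Q R f : fus_isom E Q R f ->
  exists2 g, fus_isom E R Q g & {in Q, cancel f g} /\ {in R, cancel g f}.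
Proof.
case=> EQRf defR; have [C [defC EQCf [g ECQg fK]]] := fus_iso EQRf.
have eqCR: C = R by apply: group_inj; rewrite -defR defC.
rewrite {C}eqCR in defC EQCf ECQg.
exists g; first split=> //; last split=> //.
  apply/setP=> x; rewrite -defR.
  apply/imsetP/idP=> [[_ /imsetP[y Qy ->] ->]|Qx].
    by rewrite fK.
  by exists (f x); rewrite ?imset_f ?fK.
by move=> y; rewrite -defR => /imsetP[x Qx ->]; rewrite fK.
Qed.

Lemma fus_isom_comp A B C f g :
  fus_isom E A B f -> fus_isom E B C g -> fus_isom E A C (g \o f).
Proof.
case=> Ef defB [Eg defC].
by split; rewrite ?(fus_comp Ef Eg) // imset_comp defB.
Qed.

Lemma AutE_sub_Aut Q : AutE E Q \subset Aut Q.
Proof. by apply/subsetP=> a /setIdP[]. Qed.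

Lemma AutP_sub_AutE Q : Q \subset P -> AutP P Q \subset AutE E Q.
Proof.
move=> sQP; apply/subsetP=> _ /morphimP[x nQx /setIP[Px _] ->].
rewrite inE (subsetP (Aut_conj_aut Q 'N(Q))) ?mem_morphim //=.
rewrite (fus_ext E Q (g := conjg^~ x)) => [|z Qz]; last first.
  by rewrite norm_conj_autE.
by rewrite fus_conj // (normP nQx).
Qed.

(** When [g] extends a map on X to a group normalizing X, [g n] lies in P and induces the transport
    of c_n. It supplies the witness y in the definition of N_phi. *)
Lemma fus_norm (X N M : {group gT}) (Y : {set gT}) g n :
  E N M g -> X \subset N -> N \subset 'N(X) ->
  g @: X = Y -> n \in N ->
  g n \in 'N_P(Y) /\ {in X, forall z, g (z ^ n) = g z ^ g n}.
Proof.
move=> ENg sXN nXN defY Nn.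
have gJ: {in X, forall z, g (z ^ n) = g z ^ g n}.
  by move=> z Xz; rewrite (fusJ ENg) // (subsetP sXN).
split=> //; have [_ sMP] := fus_sub ENg.
rewrite inE (subsetP sMP) ?(fus_mem ENg) // inE -defY.
apply/subsetP=> _ /imsetP[_ /imsetP[z Xz ->] ->].
by rewrite -gJ // imset_f // memJ_norm // (subsetP nXN).
Qed.

End FusionBasics.

(** * Extension relative to a Sylow subgroup, inherited from the saturated overgroup *)

(* The last clause says that [f] extends to [N] as soon as f^-1 c_n f lies in
   [T] for all n in [N]. In the saturated overgroup, [T] is Aut_S(Q). *)
Definition sylow_receptive p (gT : finGroupType) (P : {group gT})
    (E : fusion_system P) (Q : {group gT}) (T : {group {perm gT}}) : Prop :=
  [/\ p.-Sylow(AutE E Q) T, AutP P Q \subset T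
    & forall (X N : {group gT}) f,
        fus_isom E X Q f -> X \subset N -> N \subset 'N_P(X) ->
        (forall n, n \in N ->
           exists2 t, t \in T & {in X, forall z, f (z ^ n) = t (f z)}) ->
        exists2 g, E N P g & {in X, g =1 f}].

Lemma injm_preim_Sylow p (aT rT : finGroupType) (D G : {group aT})
    (f : {morphism D >-> rT}) (T : {group rT}) :
  'injm f -> G \subset D -> p.-Sylow(f @* G) T ->
  p.-Sylow(G) (G :&: f @*^-1 T).
Proof.
move=> injf sGD sylT; have sTf := pHall_sub sylT.
rewrite -(injm_pHall injf) ?morphim_setIpre ?(setIidPr sTf) //.
by rewrite subIset // sGD.
Qed.

(** Saturation of F gives a receptive conjugate of the image of X. Strong closure puts it inside the
    image of P, and the extensions it provides restrict to morphisms of E. *)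
Lemma semisaturated_sylow_receptive p (gT : finGroupType) (P : {group gT})
    (E : fusion_system P) (X : {group gT}) :
  semisaturated p E -> X \subset P ->
  exists (R : {group gT}) (T : {group {perm gT}}),
    fus_conjugate E X R /\ sylow_receptive p E R T.
Proof.
case=> sT [S [F [iota [injI [_ satF sPS closP EF]]]]] sXP.
pose im (A : {group gT}) := (iota @* A)%G.
pose conj f := iota \o f \o invm injI.
have sXS: im X \subset S by rewrite (subset_trans _ sPS) ?morphimS.
have conjE (A : {group gT}) f x :
  A \subset P -> x \in A -> conj f (iota x) = iota (f x).
  by move=> /subsetP sAP Ax; rewrite /conj /= invmE ?sAP.
(* Strong closure concerns single elements, so [g] is restricted to the cyclic group generated by
   each y. *)
have closF (A : {group gT}) (B : {group sT}) g :
    A \subset P -> F (im A) B g -> g @: (im A) \subset iota @* P.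
  move=> sAP FAg; apply/subsetP=> _ /imsetP[y Ay ->].
  have [sAS sBS] := fus_sub FAg.
  have Py: y \in iota @* P by apply: subsetP Ay; rewrite morphimS.
  apply: closP => //; apply: fus_restr (_ : F (im A) S g).
    by rewrite cycle_subG.
  apply: (fus_corestr _ _ FAg) => //; have [_ _ sgB] := fus_inj FAg.
  exact: subset_trans sgB sBS.
have unconj (A B : {group gT}) g : A \subset P -> B \subset P ->
    F (im A) (im B) g -> E A B (invm injI \o g \o iota).
  move=> sAP sBP FABg; rewrite EF //.
    rewrite (fus_ext F _ (g := g)) // => _ /morphimP[x Px Ax ->] /=.
    rewrite invmE //.
    have /morphimP[y Py By ->]: g (iota x) \in im B.
      by rewrite (fus_mem FABg) ?mem_morphim.
    by rewrite invmE.
  apply/subsetP=> _ /imsetP[x Ax ->] /=.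
  have /morphimP[y Py By ->]: g (iota x) \in im B.
    by rewrite (fus_mem FABg) ?mem_morphim ?(subsetP sAP).
  by rewrite invmE.
have [R1 [[f1 [FXf defR1]] sylR1 recR1]] := satF _ sXS.
have sR1P: R1 \subset iota @* P by rewrite -defR1 (closF _ _ _ sXP FXf).
have [R sRP imR]: exists2 R : {group gT}, R \subset P & im R = R1.
  exists (iota @*^-1 R1)%G; first exact: subsetIl.
  by apply: group_inj; rewrite /= morphpreK.
rewrite -{R1 sR1P}imR in FXf defR1 sylR1 recR1.
have domR := subsetP sRP.
have normI (A : {group gT}) x : x \in P -> x \in 'N(A) -> iota x \in 'N(im A).
  move=> Px nAx; apply: (subsetP (morphim_norm iota A)).
  by rewrite mem_morphim.
pose h := Aut_isom injI sRP.
have injh: 'injm h := injm_Aut_isom injI sRP.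
pose GE := Group (group_set_AutE E sRP).
have sGA: GE \subset Aut R := AutE_sub_Aut E R.
have hGE: h @* GE = AutE F (im R).
  apply/setP=> b; apply/morphimP/idP=> [[a Aa /setIdP[_ Ea] ->]|].
    rewrite inE Aut_Aut_isom /=.
    have Fa: F (im R) (im R) (conj a) by rewrite -EF // (fus_isomP Ea).
    rewrite (fus_ext F _ (g := conj a)) // => _ /morphimP[x Px Rx ->].
    by rewrite Aut_isomE // (conjE R).
  case/setIdP=> Ab Fb.
  have /morphimP[a _ Aa def_b]: b \in h @* Aut R by rewrite im_Aut_isom.
  exists a; rewrite // inE Aa EF //; last first.
    by apply/subsetP=> _ /imsetP[x Rx ->]; rewrite Aut_closed.
  rewrite -/(conj a) (fus_ext F _ (g := b)) // => _ /morphimP[x Px Rx ->].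
  by rewrite (conjE R) // def_b Aut_isomE.
have sylT: p.-Sylow(GE) (GE :&: h @*^-1 (AutP S (im R))).
  by apply: injm_preim_Sylow; rewrite ?hGE.
(* The Sylow subgroup is Aut_S([im R]) pulled back along [h]. It contains Aut_P(R) since P embeds in
   S. *)
exists R, (GE :&: h @*^-1 [group of AutP S (im R)])%G; split; last split=> //.
- exists (invm injI \o f1 \o iota); split; first exact: unconj.
  rewrite (imset_comp (invm injI \o f1) iota) (imset_comp (invm injI) f1).
  rewrite -[iota @: X]morphimEsub // defR1.
  by rewrite -[RHS](morphim_invm injI sRP) [RHS]morphimEsub ?morphimS.
- rewrite subsetI AutP_sub_AutE //=.
  apply/subsetP=> _ /morphimP[x nRx /setIP[Px _] ->].
  have Aa: conj_aut R x \in Aut R.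
    by rewrite (subsetP (Aut_conj_aut R 'N(R))) ?mem_morphim.
  have nRx' : iota x \in 'N(im R) by rewrite normI ?mem_morphim.
  have Sx' : iota x \in S by rewrite (subsetP sPS) ?mem_morphim.
  rewrite inE Aa inE; apply/morphimP; exists (iota x); rewrite // 1?inE ?Sx' //.
  apply: (eq_Aut (Aut_Aut_isom _ _ _)).
    by rewrite (subsetP (Aut_conj_aut _ 'N(im R))) ?mem_morphim.
  move=> _ /morphimP[z Pz Rz ->].
  rewrite Aut_isomE // !norm_conj_autE ?mem_morphim // morphJ //.
move=> Y N f [EYf defR] sYN sNN fT.
have sNP: N \subset P by rewrite (subset_trans sNN) ?subsetIl.
have sYP := subset_trans sYN sNP.
have FYf: fus_isom F (im Y) (im R) (conj f).
  split.
    by rewrite -EF // defR.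
  apply/setP=> y; apply/imsetP/idP=> [[_ /morphimP[x Px Yx ->] ->]|].
    by rewrite (conjE Y) // mem_morphim ?domR // -defR imset_f.
  rewrite /= -defR => /morphimP[_ _ /imsetP[x Yx ->] ->].
  by exists (iota x); rewrite ?(conjE Y) // mem_morphim // (subsetP sYP).
have [g FNg gE] := recR1 _ _ FYf.
(* By [fT], each n acts after transport as some y in N_S([im R]), which is the membership condition
   of N_phi in S. *)
have sNN' : im N \subset Nphi S (conj f) (im Y).
  apply/subsetP=> _ /morphimP[n Pn Nn ->].
  have /setIP[_ nYn] := subsetP sNN n Nn.
  have [t /setIP[_ /morphpreP[At hPt]] ft] := fT n Nn.
  have /morphimP[y nRy /setIP[Sy _] def_t] := hPt.
  rewrite inE in_setI normI // (subsetP sPS) ?mem_morphim //=.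
  apply/existsP; exists y; rewrite FYf.2 in_setI Sy nRy /=.
  apply/forall_inP=> _ /morphimP[z Pz Yz ->]; apply/eqP.
  rewrite -morphJ // !(conjE Y) ?memJ_norm // ft //.
  have Rfz: f z \in R by rewrite -defR imset_f.
  have ht : Aut_isom injI sRP t = conj_aut (im R) y := def_t.
  by rewrite -(Aut_isomE injI sRP) // ht norm_conj_autE ?mem_morphim ?domR.
have FNg' := fus_restr sNN' FNg.
(* Strong closure brings the image of the extension from S back into P. *)
have FNPg := fus_corestr (closF _ _ _ sNP FNg') sPS FNg'.
exists (invm injI \o g \o iota); first exact: (unconj N P).
move=> x Yx; have Px := subsetP sYP x Yx.
rewrite /= gE ?mem_morphim // (conjE Y) // invmE //.
by rewrite domR // -defR imset_f.
Qed.

(** * Transport of the extension property, receptive and reproductive subgroups *)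

Section SylowReceptive.

Variables (p : nat) (gT : finGroupType) (P : {group gT}).
Variable E : fusion_system P.
Implicit Types (N Q R X : {group gT}) (T : {group {perm gT}}).

(** The map [h] is a |-> f^-1 a f, with f acting on the right. *)
Lemma AutE_isom X R f : fus_isom E X R f ->
  exists h : {morphism Aut X >-> {perm gT}},
    [/\ 'injm h, h @* Aut X = Aut R, h @* AutE E X = AutE E R
      & forall a, a \in Aut X -> {in X, forall z, h a (f z) = f (a z)}].
Proof.
move=> isof; have [EXf defR] := isof; have [F eqF injF] := fus_mor EXf.
have [k [EXk _] [fK kK]] := fus_isom_inv isof.
have imF: F @* X = R by rewrite morphimEdom (eq_imset _ eqF).
pose h := Aut_isom injF (subxx X).
have hE a: a \in Aut X -> {in X, forall z, h a (f z) = f (a z)}.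
  by move=> Aa z Xz; rewrite -!eqF Aut_isomE.
have imh: h @* Aut X = Aut R by rewrite im_Aut_isom imF.
exists [morphism of h]; split; rewrite ?injm_Aut_isom //.
apply/setP=> b; apply/morphimP/idP=> [[a Aa /setIdP[_ Ea] ->]|].
  rewrite inE -imh mem_morphim //=.
  rewrite (fus_ext E _ (g := f \o (a \o k))).
    exact: fus_comp (fus_comp EXk Ea) EXf.
  by rewrite -defR => _ /imsetP[x Xx ->] /=; rewrite hE // fK.
case/setIdP=> Ab Eb; rewrite -imh in Ab.
have /morphimP[a _ Aa def_b] := Ab.
exists a; rewrite // inE Aa (fus_ext E _ (g := k \o (b \o f))).
  exact: fus_comp (fus_comp EXf Eb) EXk.
by move=> x Xx /=; rewrite def_b hE // fK // Aut_closed.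
Qed.

Lemma conj_autP Q x : x \in 'N_P(Q) -> conj_aut Q x \in AutP P Q.
Proof. by move=> NQx; rewrite mem_morphim //; case/setIP: NQx. Qed.

Lemma conj_aut_Aut Q x : x \in 'N(Q) -> conj_aut Q x \in Aut Q.
Proof. by move=> Nx; rewrite (subsetP (Aut_conj_aut Q 'N(Q))) ?mem_morphim. Qed.

Lemma fus_conj_sub X R : fus_conjugate E X R -> X \subset P /\ R \subset P.
Proof. by case=> f [/fus_sub]. Qed.

(* Sylow's theorem in Aut_E(R) moves the transported Aut_P(X) into [T]. *)
Lemma sylow_receptive_norm_ext R T X :
  p.-group P -> sylow_receptive p E R T -> fus_conjugate E X R ->
  exists2 g, E 'N_P(X)%G 'N_P(R)%G g & g @: X = R.
Proof.
move=> pP [sylT _ extT] [f0 iso0]; have [EXf0 def_R] := iso0.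
have [sXP sRP] := fus_sub EXf0.
have [h [injh imh hE hP]] := AutE_isom iso0.
pose GE := Group (group_set_AutE E sRP).
have sA0: h @* AutP P X \subset GE.
  by rewrite /= -hE morphimS // AutP_sub_AutE.
have pA0: p.-group (h @* AutP P X).
  by rewrite !morphim_pgroup // (pgroupS (subsetIl _ _) pP).
have [a GEa sA0T] := @Sylow_Jsub p _ GE T _ sylT sA0 pA0.
have [_ Ea] := setIdP GEa.
(* Following [f0] by [a] replaces the transported Aut_P(X) by its [a]-conjugate inside [T], so all
   of N_P(X) meets the extension condition. *)
have isof: fus_isom E X R (a \o f0).
  by apply: fus_isom_comp iso0 _; split; last exact: fus_isomP Ea.
have sXN: X \subset 'N_P(X) by rewrite subsetI sXP normG.
have [|g ENg eqg] := extT X 'N_P(X)%G _ isof sXN (subxx _).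
  move=> n NXn; have /setIP[Pn nXn] := NXn.
  exists (h (conj_aut X n) ^ a).
    apply: (subsetP sA0T); rewrite memJ_conjg mem_morphim ?conj_autP //.
    exact: conj_aut_Aut.
  by move=> z Xz; rewrite /= permJ hP ?conj_aut_Aut // norm_conj_autE.
have def_gX: g @: X = R by rewrite (eq_in_imset eqg) isof.2.
exists g => //; apply: (fus_corestr _ _ ENg); rewrite ?subsetIl //.
apply/subsetP=> _ /imsetP[n Nn ->].
by have [] := fus_norm ENg sXN (subsetIr _ _) def_gX Nn.
Qed.

(** An injection of N_P(Q) into N_P(R) is onto when Q is fully normalized. Its inverse [k] carries
    extensions found for R back to Q, with [T] pulled back as Sylow subgroup. *)
Lemma fully_normalized_sylow_receptive Q R T :
  p.-group P -> fully_normalized E Q -> sylow_receptive p E R T ->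
  fus_conjugate E Q R ->
  exists T' : {group {perm gT}}, sylow_receptive p E Q T'.
Proof.
move=> pP [sQP maxQ] recR cQR; have [_ sRP] := fus_conj_sub cQR.
have [sylT sAT extT] := recR.
have [g ENg defR] := sylow_receptive_norm_ext pP recR cQR.
have sQN: Q \subset 'N_P(Q) by rewrite subsetI sQP normG.
have [k [EkN _] [gK _]]: exists2 k, fus_isom E 'N_P(R)%G 'N_P(Q)%G k &
    {in 'N_P(Q), cancel g k} /\ {in 'N_P(R), cancel k g}.
  apply: fus_isom_inv; split=> //; apply/eqP.
  rewrite eqEcard (card_fus ENg) // maxQ // andbT.
  by have [] := fus_inj ENg.
have isog: fus_isom E Q R g.
  by split=> //; apply: fus_corestr (fus_restr sQN ENg); rewrite ?defR.
have [h [injh imh hE hP]] := AutE_isom isog.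
pose GE := Group (group_set_AutE E sQP).
have sGA: GE \subset Aut Q := AutE_sub_Aut E Q.
exists (GE :&: h @*^-1 T)%G; split.
- by apply: injm_preim_Sylow; rewrite /= ?hE.
- rewrite subsetI AutP_sub_AutE //=.
  apply/subsetP=> _ /morphimP[x nQx NQx ->].
  have [NRgx gJ] := fus_norm ENg sQN (subsetIr _ _) defR NQx.
  have Aa := conj_aut_Aut nQx.
  rewrite inE Aa inE (subsetP sAT) //.
  suffices ->: h (conj_aut Q x) = conj_aut R (g x) by apply: conj_autP.
  have nRgx: g x \in 'N(R) by case/setIP: NRgx.
  apply: (@eq_Aut _ R); rewrite -?imh ?mem_morphim // ?imh ?conj_aut_Aut //.
  rewrite -defR => _ /imsetP[z Qz ->].
  by rewrite hP // !norm_conj_autE // ?gJ // -defR imset_f.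
move=> X N f isof sXN sNN fT; have [EXf defQ] := isof.
have fQ: {in X, forall z, f z \in Q} by move=> z Xz; apply: fus_mem EXf Xz.
have isogf := fus_isom_comp isof isog.
have [|e ENe eqe] := extT X N _ isogf sXN sNN.
  move=> n Nn; have [t /setIP[_ /morphpreP[At Tht]] ft] := fT n Nn.
  by exists (h t) => // z Xz; rewrite /= ft // hP // fQ.
have def_eX: e @: X = R by rewrite (eq_in_imset eqe) isogf.2.
have nXN: N \subset 'N(X) by rewrite (subset_trans sNN) ?subsetIr.
(* The extension has to land in N_P(R), the domain of [k]. *)
have ENe': E N 'N_P(R)%G e.
  apply: (fus_corestr _ _ ENe); rewrite ?subsetIl //.
  apply/subsetP=> _ /imsetP[n Nn ->].
  by have [] := fus_norm ENe sXN nXN def_eX Nn.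
exists (k \o e).
  apply: fus_corestr (fus_comp ENe' EkN) => //.
  have [_ _] := fus_inj (fus_comp ENe' EkN).
  by move/subset_trans; apply; apply: subsetIl.
by move=> z Xz; rewrite /= eqe //= gK // (subsetP sQN) // fQ.
Qed.

Lemma sub_Nphi Q f : E Q P f -> Q \subset Nphi P f Q.
Proof.
move=> EQf; have [sQP _] := fus_sub EQf.
apply/subsetP=> x Qx.
rewrite inE in_setI (subsetP sQP) // (subsetP (normG Q)) //.
have [F eqF _] := fus_mor EQf.
apply/existsP; exists (f x); rewrite in_setI (fus_mem EQf) //=.
have -> : f @: Q = F @* Q by rewrite morphimEdom (eq_imset _ eqF).
rewrite -[f x]eqF (subsetP (normG (F @* Q))) ?mem_morphim //=.
by apply/forall_inP=> z Qz; rewrite eqF (fusJ EQf).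
Qed.

(** Elements of N_f(R) induce on Q elements of Aut_P(Q), which lies in [T]. *)
Lemma sylow_receptive_receptive Q T :
  Q \subset P -> sylow_receptive p E Q T -> receptive E Q.
Proof.
move=> sQP [_ sAT extT] R f isof; have [ERf defQ] := isof.
have [sRP _] := fus_sub ERf.
apply: (extT R (Nphi_group P f R)) => //=.
- by apply: sub_Nphi; apply: (fus_corestr _ _ ERf); rewrite ?defQ.
- by apply/subsetP=> x /setIdP[].
move=> n /setIdP[_ /existsP[y /andP[Ny /forall_inP fJ]]].
rewrite defQ in Ny; exists (conj_aut Q y).
  by rewrite (subsetP sAT) ?conj_autP.
case/setIP: Ny => _ nQy z Rz.
by rewrite (eqP (fJ z Rz)) norm_conj_autE // -defQ imset_f.
Qed.

(** A suitable map X -> Q extends to all of N_P(X), so its N_phi is N_P(X), which exceeds X because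
    normalizers grow in p-groups. *)
Lemma sylow_receptive_reproductive Q T :
  p.-group P -> Q \proper P -> sylow_receptive p E Q T -> reproductive E Q.
Proof.
move=> pP prQP recQ; have sQP := proper_sub prQP.
split=> //; first exact: sylow_receptive_receptive recQ.
move=> X [f0 iso0]; have [k isok _] := fus_isom_inv iso0.
have cXQ: fus_conjugate E X Q by exists k.
have [sXP _] := fus_conj_sub cXQ.
have [g ENg defQ] := sylow_receptive_norm_ext pP recQ cXQ.
have sXN: X \subset 'N_P(X) by rewrite subsetI sXP normG.
have prXP: X \proper P.
  by rewrite properEcard sXP -(card_fus ENg sXN) defQ proper_card.
exists g; first by apply: fus_corestr (fus_restr sXN ENg); rewrite ?defQ.
apply: proper_sub_trans (nilpotent_proper_norm (pgroup_nil pP) prXP) _.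
apply/subsetP=> x Nx; rewrite inE Nx; apply/existsP; exists (g x).
have [NQgx gJ] := fus_norm ENg sXN (subsetIr _ _) defQ Nx.
by rewrite defQ NQgx; apply/forall_inP=> z Xz; rewrite gJ.
Qed.

(** * Strong closure and the passage to outer automorphisms *)

Lemma Inn_sub_AutP Q : Q \subset P -> Inn Q \subset AutP P Q.
Proof. by move=> sQP; rewrite morphimS // subsetI sQP normG. Qed.

(** Turns the pointwise condition defining N_phi into an equation between automorphisms. *)
Lemma conj_autJ Q a x y : a \in Aut Q -> x \in 'N(Q) -> y \in 'N(Q) ->
  {in Q, forall z, a (z ^ x) = a z ^ y} -> conj_aut Q x ^ a = conj_aut Q y.
Proof.
move=> Aa nQx nQy aJ.
apply: (@eq_Aut _ Q); rewrite ?groupJ ?conj_aut_Aut // => z Qz.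
rewrite -[z](permKV a) permJ.
have Qw: a^-1 z \in Q by rewrite Aut_closed ?groupV.
have Qaw := Aut_closed Aa Qw.
by rewrite !norm_conj_autE // aJ.
Qed.

Lemma Inn_normal_Aut Q : Inn Q <| Aut Q.
Proof.
rewrite /normal Aut_conj_aut; apply/subsetP=> a Aa.
rewrite inE; apply/subsetP=> _ /imsetP[_ /morphimP[x nQx Qx ->] ->].
have Qax: a x \in Q by rewrite Aut_closed.
have nQax := subsetP (normG Q) _ Qax.
rewrite (conj_autJ (y := a x)) ?mem_morphim // => z Qz.
by rewrite -(autmE Aa) morphJ.
Qed.

Lemma Inn_normal_AutE Q (sQP : Q \subset P) :
  Inn Q <| Group (group_set_AutE E sQP).
Proof.
have /andP[_ nIA] := Inn_normal_Aut Q.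
rewrite /normal (subset_trans (Inn_sub_AutP sQP)) ?AutP_sub_AutE //=.
exact: subset_trans (AutE_sub_Aut E Q) nIA.
Qed.

(** If c_n^a lies in [T], then [a] extends to some [e] defined at n, and c_n^a is conjugation by
    [e n], an element of P. *)
Lemma AutP_strongly_closed Q T :
  Q \subset P -> sylow_receptive p E Q T ->
  strongly_closed (AutP P Q) T (AutE E Q).
Proof.
move=> sQP [sylT sAT extT]; split=> //; first exact: pHall_sub sylT.
move=> _ a /morphimP[n nQn NQn ->] Ea Tna.
have [Aa EQa] := setIdP Ea; have imQ := fus_isomP EQa.
(* These are the x in N_P(Q) with c_x^a in [T], exactly what the extension property asks of a domain
   for [a]. *)
pose N := ('N_P(Q) :&: conj_aut Q @*^-1 (T :^ a^-1))%G.
have Nn: n \in N.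
  by rewrite in_setI NQn inE nQn inE mem_conjgV.
have sQN: Q \subset N.
  rewrite subsetI subsetI sQP normG; apply/subsetP=> x Qx.
  have nQx := subsetP (normG Q) x Qx.
  rewrite inE nQx inE mem_conjgV (subsetP sAT) //.
  rewrite (subsetP (Inn_sub_AutP sQP)) // memJ_norm ?mem_morphim //.
  by case/andP: (Inn_normal_Aut Q) => _ /subsetP ->.
have sNN: N \subset 'N_P(Q) by apply: subsetIl.
have [|e ENe eqe] := extT Q N a (conj EQa imQ) sQN sNN.
  move=> m /setIP[/setIP[_ nQm] /morphpreP[_]]; rewrite mem_conjgV => Tma.
  by exists (conj_aut Q m ^ a) => // z Qz; rewrite permJ norm_conj_autE.
have eQ: e @: Q = Q by rewrite (eq_in_imset eqe).
have [Nen eJ] := fus_norm ENe sQN (subset_trans sNN (subsetIr _ _)) eQ Nn.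
rewrite (conj_autJ (y := e n)) ?conj_autP //; first by case/setIP: Nen.
by move=> z Qz; rewrite -!eqe ?memJ_norm // eJ.
Qed.

(** As Inn(Q) lies in [T], [T] is the full preimage of its quotient, so membership of a coset lifts
    to representatives. *)
Lemma OutP_strongly_closed Q T :
  Q \subset P -> sylow_receptive p E Q T ->
  p.-Sylow(OutE E Q) (T / Inn Q) /\
  strongly_closed (OutP P Q) (T / Inn Q) (OutE E Q).
Proof.
move=> sQP recQ; have [sDT sTA clD] := AutP_strongly_closed sQP recQ.
have [sylT _ _] := recQ.
have nIA: AutE E Q \subset 'N(Inn Q) := normal_norm (Inn_normal_AutE sQP).
have nIT := subset_trans sTA nIA.
have sIT: Inn Q \subset T by rewrite (subset_trans (Inn_sub_AutP sQP)).
split; first exact: (@quotient_pHall _ _ (Group (group_set_AutE E sQP))).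
split; rewrite ?morphimS //.
move=> _ _ /morphimP[d nd Dd ->] /morphimP[a na Aa ->].
rewrite -morphJ //= => Tda; have nda: d ^ a \in 'N(Inn Q) by rewrite groupJ.
apply: mem_morphim => //; apply: clD => //.
rewrite -(quotientGK (H := Inn Q) (G := T)); last first.
  exact/andP.
by rewrite inE nda inE.
Qed.

(** If x acts on Q as some y in Q, then x y^-1 lies in C_P(Q), hence in Q by centricity. *)
Lemma conj_aut_Inn Q x :
  fus_centric E Q -> x \in 'N_P(Q) ->
  (coset (Inn Q) (conj_aut Q x) == 1) = (x \in Q).
Proof.
move=> [sQP cenQ] /setIP[Px nQx]; apply/eqP/idP=> [/coset_idr|Qx]; last first.
  by rewrite coset_id // mem_morphim.
have cQQ: 'C_P(Q) \subset Q.
  apply: cenQ; exists id; split; first exact: fus_incl.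
  exact: imset_id.
have /andP[_ nIA] := Inn_normal_Aut Q.
move=> Ix; have /morphimP[y nQy Qy eqxy]: conj_aut Q x \in Inn Q.
  by apply: Ix; apply: (subsetP nIA); apply: conj_aut_Aut.
rewrite -(mulgKV y x) groupM // (subsetP cQQ) // in_setI.
rewrite groupM ?groupV // ?(subsetP sQP) //= -ker_conj_aut.
by rewrite -mem_rcoset; apply/rcoset_kerP.
Qed.

(** An x in N_P(Q) lies in N_a(Q) iff c_x^a is in Aut_P(Q), and by centricity c_x has trivial class
    only for x in Q. Thus elements of N_a(Q) outside Q give the nontrivial elements of the
    intersection. *)
Lemma proper_Nphi Q a :
  fus_centric E Q -> a \in AutE E Q ->
  (Q \proper Nphi P a Q)
    = (OutP P Q :&: OutP P Q :^ coset (Inn Q) a != 1).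
Proof.
move=> cenQ EQa; have [Aa Ea] := setIdP EQa; have imQ := fus_isomP Ea.
have [sQP _] := cenQ.
have /andP[_ nIA] := Inn_normal_Aut Q.
have nIa: a \in 'N(Inn Q) by apply: (subsetP nIA).
have AutPJ x : x \in 'N_P(Q) ->
    (conj_aut Q x ^ a \in AutP P Q) = (x \in Nphi P a Q).
  move=> Nx; have [_ nQx] := setIP Nx; rewrite inE Nx imQ /=.
  apply/morphimP/existsP=> [[y nQy NQy eqxy]|[y /andP[NQy /forall_inP aJ]]].
    exists y; rewrite NQy; apply/forall_inP=> z Qz.
    rewrite -(norm_conj_autE nQx Qz) -permJ eqxy norm_conj_autE //.
    exact: Aut_closed.
  have nQy: y \in 'N(Q) by case/setIP: NQy.
  exists y => //; apply: conj_autJ => // z Qz.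
  exact/eqP/aJ.
have nIx x : x \in 'N_P(Q) -> conj_aut Q x \in 'N(Inn Q).
  by case/setIP=> _ nQx; apply: (subsetP nIA); apply: conj_aut_Aut.
have sIP := Inn_sub_AutP sQP.
have nIP: AutP P Q \subset 'N(Inn Q).
  exact: subset_trans (Aut_conj_aut _ _) nIA.
apply/idP/trivgPn=> [/properP[_ [x Nx notQx]] | [u /setIP[Du Dau] ntu]].
  have NPx: x \in 'N_P(Q) by case/setIdP: Nx.
  have Px: conj_aut Q x ^ a \in AutP P Q by rewrite AutPJ.
  exists (coset (Inn Q) (conj_aut Q x ^ a)); last first.
    by rewrite morphJ ?nIx // conjg_eq1 conj_aut_Inn.
  rewrite in_setI mem_morphim //=; last by rewrite groupJ ?nIx.
  by rewrite morphJ ?nIx // memJ_conjg mem_morphim ?nIx ?conj_autP.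
have /imsetP[_ /morphimP[_ _ /morphimP[x nQx NQx ->] ->] def_u] := Dau.
rewrite def_u conjg_eq1 conj_aut_Inn // in ntu.
rewrite def_u -morphJ ?nIx //= in Du.
apply/properP; split.
  by apply: sub_Nphi; apply: (fus_corestr _ _ Ea); rewrite ?imQ.
exists x => //; rewrite -AutPJ //.
have nIxa: conj_aut Q x ^ a \in 'N(Inn Q) by rewrite groupJ ?nIx.
have nsIP: Inn Q <| AutP P Q by apply/andP.
(* Aut_P(Q) contains Inn(Q), so membership may be tested modulo Inn(Q). *)
have <-: coset (Inn Q) @*^-1 OutP P Q = AutP P Q := quotientGK nsIP.
by rewrite inE nIxa inE.
Qed.

Lemma OutP_neq1 Q :
  p.-group P -> fus_centric E Q -> (OutP P Q != 1) = (Q \proper P).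
Proof.
move=> pP cenQ; have [sQP _] := cenQ.
apply/trivgPn/idP=> [[_ /morphimP[_ _ /morphimP[x _ Nx ->] ->]] | prQP].
  rewrite conj_aut_Inn // => notQx; apply/properP; split=> //.
  by exists x => //; case/setIP: Nx.
have /properP[_ [x Nx notQx]] := nilpotent_proper_norm (pgroup_nil pP) prQP.
exists (coset (Inn Q) (conj_aut Q x)); last by rewrite conj_aut_Inn.
have [_ nQx] := setIP Nx; have /andP[_ nIA] := Inn_normal_Aut Q.
by rewrite mem_morphim ?conj_autP // (subsetP nIA) // conj_aut_Aut.
Qed.

End SylowReceptive.

(** * Strongly embedded subgroups of an abstract finite group *)

Section StronglyEmbedded.

Variables (p : nat) (rT : finGroupType) (G D : {group rT}).
Let S := [set g in G | D :&: D :^ g != 1].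

(** The key is [embH]: a conjugate of a nontrivial U <= D by x lies in [<<S>>] only if x does.
    Applied to x and x g^-1, it forces g into [<<S>>]. *)
Lemma strongly_embedded_gen (T : {group rT}) :
  p.-Sylow(G) T -> strongly_closed D T G -> D :!=: 1 -> <<S>> \proper G ->
  strongly_embedded p D G <<S>>%G.
Proof.
move=> sylT clD ntD prS; have [sDT sTG scD] := clD.
have sDG := subset_trans sDT sTG.
have sSH: S \subset <<S>> := subset_gen S.
have sTH: T \subset <<S>>.
  apply/subsetP=> t Tt; apply: (subsetP sSH); rewrite inE (subsetP sTG) //=.
  (* Strong closure makes T normalize D, so D meets D^t in D itself. *)
  have /normP ->: t \in 'N(D); last by rewrite setIid.
  rewrite inE; apply/subsetP=> _ /imsetP[d Dd ->].
  by rewrite scD ?(subsetP sTG) // groupJ // (subsetP sDT).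
have sylTH: p.-Sylow(<<S>>) T.
  by apply: pHall_subl sylT => //; apply: proper_sub.
(* Conjugate [U :^ x] into [T] inside [<<S>>]; strong closure puts it in [D]. *)
have embH (U : {group rT}) x : x \in G -> U \subset D -> U :!=: 1 ->
    U :^ x \subset <<S>> -> x \in <<S>>.
  move=> Gx sUD ntU sUxH; have pUx: p.-group (U :^ x).
    rewrite pgroupJ (pgroupS sUD) // (pgroupS sDT) //.
    exact: pHall_pgroup sylT.
  have [h Hh sUT] := Sylow_Jsub sylTH sUxH pUx.
  have Gh: h \in G by apply: (subsetP (proper_sub prS)).
  rewrite -(groupMr _ Hh) (subsetP sSH) // inE groupM //=.
  rewrite -conjsgM in sUT.
  have sUDD: U :^ (x * h) \subset D :&: D :^ (x * h).
    rewrite subsetI conjSg sUD andbT.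
    apply/subsetP=> _ /imsetP[u Uu ->] /=.
    have Du: u \in D by apply: (subsetP sUD).
    have Tu: u ^ (x * h) \in T by apply: (subsetP sUT); rewrite memJ_conjg.
    exact: scD Du (groupM Gx Gh) Tu.
  by apply: contraNneq ntU => D1; rewrite D1 sub_conjg conjs1g subG1 in sUDD.
split=> //.
- by exists T.
- by exists 1; rewrite ?conjsg1 // (subset_trans sDT).
move=> g x U /setDP[Gg notHg] Gx sUD ntU; apply: contra notHg.
rewrite subsetI => /andP[sUH sUHg].
have Hx := embH U x Gx sUD ntU sUH.
have Hxg: x * g^-1 \in <<S>>.
  by apply: (embH U) => //; rewrite ?groupM ?groupV // conjsgM sub_conjgV.
by rewrite -groupV -(groupMl _ Hx).
Qed.

(** Up to conjugation by x, H contains D and therefore every g for which D meets D^g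
    nontrivially. *)
Lemma strongly_embedded_gen_proper (H : {group rT}) :
  strongly_embedded p D G H -> <<S>> \proper G.
Proof.
case=> _ _ prH [x Gx sDxH] embH.
have sHG := proper_sub prH.
suffices sSH: <<S>> \subset H :^ x^-1.
  apply: sub_proper_trans sSH _.
  by rewrite -(conjGid (groupVr Gx)) properJ.
rewrite gen_subG; apply/subsetP=> g /setIdP[Gg ntDg].
rewrite mem_conjgV; apply: contraR ntDg => notHgx.
have Ggx: g ^ x \in G :\: H by rewrite inE notHgx groupJ.
apply: contraT => ntDg.
(* Take U = D :&: D^g; since g x = x g^x, U^x lies in both H and H^(g^x). *)
have /negP[] := embH _ _ (D :&: D :^ g)%G Ggx Gx (subsetIl _ _) ntDg.
by rewrite conjIg -conjsgM conjgC conjsgM setISS // conjSg.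
Qed.

End StronglyEmbedded.

(** * Descent of the generated subgroup from Aut_E(Q) to Out_E(Q), and the equivalence *)

Theorem corollary3p22 (p : nat) (gT : finGroupType) (P : {group gT})
    (E : fusion_system P) (Q : {group gT}) :
  prime p -> p.-group P -> semisaturated p E ->
  fully_normalized E Q -> fus_centric E Q ->
  (essential E Q <->
   exists H : {group coset_of (Inn Q)},
     strongly_embedded p (OutP P Q) (OutE E Q) H).
Proof.
move=> _ pP ssE fnQ cenQ; have [sQP _] := cenQ.
have [R [T0 [cQR recR]]] := semisaturated_sylow_receptive ssE sQP.
have [T recQ] := fully_normalized_sylow_receptive pP fnQ recR cQR.
have [sylT clD] := OutP_strongly_closed sQP recQ.
pose A := Group (group_set_AutE E sQP).
have nsIA : Inn Q <| A := Inn_normal_AutE E sQP.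
have nIA := normal_norm nsIA.
pose D := (conj_aut Q @* 'N_P(Q) / Inn Q)%G.
pose SA := [set a in AutE E Q | Q \proper Nphi P a Q].
pose S := [set g in (A / Inn Q)%G | D :&: D :^ g != 1].
have sSA : SA \subset A by apply/subsetP=> a /setIdP[].
have defS : SA / Inn Q = S.
  apply/setP=> u; apply/morphimP/setIdP=> [[a na /setIdP[Ea prN] ->]|].
    by rewrite -(proper_Nphi cenQ Ea) mem_morphim.
  case=> /morphimP[a na Ea ->] ntDa; exists a => //.
  by rewrite inE Ea (proper_Nphi cenQ Ea).
have propS : Q \proper P -> (<<SA>> \proper A) = (<<S>> \proper A / Inn Q).
  rewrite -(OutP_neq1 pP cenQ) => ntD.
  rewrite -defS -quotient_gen ?(subset_trans sSA) // quotient_proper //.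
  (* Classes of elements of Aut_P(Q) lie in D and fix it under conjugation, so D <> 1 puts Aut_P(Q)
     in [SA]. Hence [<<SA>>] contains Inn(Q), and properness can be read in the quotient. *)
  have sAG : AutP P Q \subset <<SA>>.
    apply: subset_trans (subset_gen _); apply/subsetP=> a Pa.
    have Ea := subsetP (AutP_sub_AutE E sQP) a Pa.
    have na := subsetP nIA a Ea.
    rewrite inE Ea (proper_Nphi cenQ Ea) conjGid ?setIid //=.
    exact: mem_morphim.
  apply: normalS nsIA; rewrite ?gen_subG //.
  exact: subset_trans (Inn_sub_AutP sQP) sAG.
split=> [[[prQP _ _] prSA] | [H embH]].
  exists <<S>>%G.
  apply: (@strongly_embedded_gen _ _ (A / Inn Q)%G D _ sylT clD).
    by rewrite (OutP_neq1 pP cenQ).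
  by rewrite -propS.
have prQP : Q \proper P.
  by case: embH => _ ntD _ _ _; rewrite -(OutP_neq1 pP cenQ).
split; first exact: sylow_receptive_reproductive pP prQP recQ.
by rewrite [_ \proper _](propS prQP);
  apply: (@strongly_embedded_gen_proper p _ (A / Inn Q)%G D H).
Qed.
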